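(* Let $T$ be an infinite tree and let $G$ be a closed subgroup of $\mathrm{Aut}(T)$. Assume that $G$ has property H and that $G$ leaves no proper non-empty subtree of $T$ invariant. Then the quasi-center of $G$ is trivial.
   Context: A tree is a connected simple graph without non-trivial cycles; it is not assumed to be locally finite. $\mathrm{Aut}(T)$ carries the permutation topology coming from its action on the vertex set $VT$, in which the pointwise stabilizers of finite subsets of $VT$ form a neighbourhood basis of the identity; ''closed'' refers to this topology and $G$ carries the induced topology. If $e$ is an edge of $T$ such that both components of $T\setminus\{e\}$ are infinite, each of these components is called a half-tree of $T$. A subgroup $G\le\mathrm{Aut}(T)$ has property H if for every half-tree of $T$ the subgroup of elements of $G$ fixing every vertex of that half-tree is non-trivial. The quasi-center of a topological group $G$ is the set of all elements of $G$ whose centralizer in $G$ is open. *)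

(* Defs.v *)
From HB Require Import structures.
From mathcomp Require Import all_boot.
From mathcomp Require Import boolp classical_sets cardinality filter topology.

Set Implicit Arguments.
Unset Strict Implicit.
Unset Printing Implicit Defensive.

Local Open Scope classical_set_scope.
Local Open Scope group_scope.

Section Graphs.
Variables (V : choiceType) (e : rel V).

Definition reachable (x y : V) : Prop := exists2 p, path e x p & y = last x p.

Definition component (x : V) : set V := [set y | reachable x y].

(* A cycle of length at most 2 runs back and forth along an edge and is
   therefore trivial. The empty graph is a tree in this sense. *)
Definition is_tree : Prop :=
  [/\ irreflexive e, symmetric e, forall x y, reachable x y
    & forall c : seq V, (2 < size c)%N -> ~ ucycle e c].

Definition delete_edge (x y : V) : rel V :=
  [rel u v | e u v && ~~ ((u == x) && (v == y) || (u == y) && (v == x))].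

End Graphs.

Definition half_tree (V : choiceType) (e : rel V) (H : set V) : Prop :=
  exists x y : V,
    [/\ e x y,
        forall z, infinite_set (component (delete_edge e x y) z)
      & exists z, H = component (delete_edge e x y) z].

(* Here [S] is coerced to the type of its elements. A connected subgraph of a
   tree contains every edge of the tree between two of its vertices, so
   subtrees can be identified with their vertex sets. *)
Definition subtree (V : choiceType) (e : rel V) (S : set V) : Prop :=
  is_tree (fun u v : S => e (val u) (val v)).

Record aut (V : choiceType) (e : rel V) := Aut {
  aut_fun :> V -> V;
  aut_bij : bijective aut_fun;
  aut_mono : {mono aut_fun : x y / e x y}
}.

Section AutGroup.
Variables (V : choiceType) (e : rel V).
Implicit Types g h k : aut e.

HB.instance Definition _ := gen_eqMixin (aut e).
HB.instance Definition _ := gen_choiceMixin (aut e).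

Lemma autP g h : g =1 h -> g = h.
Proof.
case: g h => [f fb fm] [f' f'b f'm] /= /funext ff'; subst f'.
by congr Aut; exact: Prop_irrelevance.
Qed.

Definition aut1 : aut e := @Aut V e id (inv_bij (fun=> erefl)) (fun _ _ => erefl).

Lemma aut_mul_mono g h : {mono g \o h : x y / e x y}.
Proof. by move=> x y; rewrite /= !aut_mono. Qed.

Definition aut_mul g h : aut e :=
  Aut (bij_comp (aut_bij g) (aut_bij h)) (aut_mul_mono g h).

Lemma aut_inv_subproof g : exists h, cancel g h /\ cancel h g.
Proof.
case: (aut_bij g) => f gK fK.
have fm : {mono f : x y / e x y} by move=> x y; rewrite -(aut_mono g) !fK.
by exists (Aut (Bijective fK gK) fm).
Qed.

Definition aut_inv g : aut e := sval (cid (aut_inv_subproof g)).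

Lemma aut_invK g : cancel g (aut_inv g).
Proof. by rewrite /aut_inv; case: cid => h []. Qed.

Lemma aut_invKV g : cancel (aut_inv g) g.
Proof. by rewrite /aut_inv; case: cid => h []. Qed.

Fact aut_mulA : associative aut_mul. Proof. by move=> g h k; exact: autP. Qed.
Fact aut_mul1g : left_id aut1 aut_mul. Proof. by move=> g; exact: autP. Qed.
Fact aut_mulg1 : right_id aut1 aut_mul. Proof. by move=> g; exact: autP. Qed.
Fact aut_mulVg : left_inverse aut1 aut_inv aut_mul.
Proof. by move=> g; apply: autP => x; exact: aut_invK. Qed.
Fact aut_mulgV : right_inverse aut1 aut_inv aut_mul.
Proof. by move=> g; apply: autP => x; exact: aut_invKV. Qed.

HB.instance Definition _ := isGroup.Build (aut e)
  aut_mulA aut_mul1g aut_mulg1 aut_mulVg aut_mulgV.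

Lemma autM g h x : (g * h) x = g (h x). Proof. by []. Qed.
Lemma aut1E x : (1 : aut e) x = x. Proof. by []. Qed.

End AutGroup.

Definition fixator (V : choiceType) (e : rel V) (F : set V) : set (aut e) :=
  [set g | forall x, F x -> g x = x].
Arguments fixator {V} e F.

Section PermutationTopology.
Variables (V : choiceType) (e : rel V).
Implicit Types g h : aut e.

(* The neighbourhoods of [g] are the supersets of the cosets of the
   pointwise stabilizers of finite sets of vertices. *)
Definition aut_nbhs g : set_system (aut e) :=
  [set A | exists2 F : set V, finite_set F &
    [set g * h | h in fixator e F] `<=` A].

HB.instance Definition _ := hasNbhs.Build (aut e) aut_nbhs.

Fact aut_nbhs_filter g : ProperFilter (nbhs g).
Proof.
split.
  move=> [F _ sF0]; apply: (sF0 (g * 1)).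
  by exists 1 => // x _.
split.
- by exists set0.
- move=> A B [F finF sFA] [F' finF' sFB].
  exists (F `|` F'); first by rewrite finite_setU.
  move=> _ [h hF <-]; split.
    by apply: sFA; exists h => // x Fx; apply: hF; left.
  by apply: sFB; exists h => // x Fx; apply: hF; right.
- move=> A B sAB [F finF sFA]; exists F => //.
  exact: subset_trans sFA sAB.
Qed.

Fact aut_nbhs_singleton g (A : set (aut e)) : nbhs g A -> A g.
Proof.
by move=> [F _ sFA]; rewrite -[g]mulg1; apply: sFA; exists 1 => // x _.
Qed.

Fact aut_nbhs_nbhs g (A : set (aut e)) : nbhs g A -> nbhs g (nbhs^~ A).
Proof.
move=> [F finF sFA]; exists F => // _ [h hF <-]; exists F => // _ [k kF <-].
apply: sFA; exists (h * k); last by rewrite mulgA.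
by move=> x Fx; rewrite autM kF // hF.
Qed.

HB.instance Definition _ := Nbhs_isNbhsTopological.Build (aut e)
  aut_nbhs_filter aut_nbhs_singleton aut_nbhs_nbhs.

End PermutationTopology.

Section Subgroups.
Variables (V : choiceType) (e : rel V).
Implicit Type G : set (aut e).

Definition property_H G : Prop :=
  forall H : set V, half_tree e H ->
    exists2 g, (G `&` fixator e H) g & g != 1.

Definition invariant_under G (S : set V) : Prop :=
  forall g, G g -> [set g x | x in S] = S.

Definition centralizer_in G (g : aut e) : set (aut e) :=
  [set h | G h /\ commute g h].

Definition quasi_center G : set (aut e) :=
  [set g | G g /\ open (centralizer_in G g : set (subspace G))].

End Subgroups.

(* Main.v *)
Require Import Defs.
From mathcomp Require Import all_boot.
From mathcomp Require Import boolp classical_sets cardinality filter topology.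

Set Implicit Arguments.
Unset Strict Implicit.
Unset Printing Implicit Defensive.

Local Open Scope classical_set_scope.
Local Open Scope group_scope.

(** The idea is to produce, for a quasi-central [g] moving some vertex [v], a
   half-tree [H] which contains a given finite set [F] of vertices and whose
   translates [g ^+ n H], for [n >= 0], cover the tree. This is enough: choose
   [F] such that the elements of [G] fixing [F] commute with [g]. By property H
   some [h != 1] in [G] fixes [H], hence [F], hence commutes with [g]; so [h]
   fixes every [g ^+ n H], that is, every vertex: a contradiction.

   Minimality enters only through the absence of leaves: the vertices with at
   least two neighbours span an invariant subtree, non-empty since the tree is
   infinite ([no_leaves]). Without leaves, a side of an edge always contains a
   smaller side missing any given finite set ([side_avoid]); in particular all
   sides are infinite, so that sides of edges are half-trees.

   To find [H], let [p] be the neighbour of [v] towards [g v], and let [A] be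
   the side of [v] with respect to the edge [v p], so that [g v] is not in [A].
   - If [v] is not in [g A], then [A] and [g A] are disjoint. Shrink [A] to a
     side missing [F]; its complement [H] and [g H] already cover the tree.
   - If [v] is in [g A], then [g A] contains [A] and all the neighbours of [A]
     ([g] is then hyperbolic). So the [g ^+ n A] increase to the whole tree,
     some [g ^+ n A] contains [F], and it can serve as [H]. *)

(** * Reachability and the sides of an edge *)

Section Reachable.
Variables (V : choiceType) (e : rel V).

Lemma reachable_refl x : reachable e x x.
Proof. by exists [::]. Qed.

Lemma reachable_cons x y z : e x y -> reachable e y z -> reachable e x z.
Proof. by move=> xy [p yp ->]; exists (y :: p); rewrite /= ?xy. Qed.

Lemma reachable_rcons x y z : reachable e x y -> e y z -> reachable e x z.
Proof.
by move=> [p xp ->] yz; exists (rcons p z); rewrite ?rcons_path ?xp ?last_rcons.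
Qed.

Lemma reachable_ind (P : set V) x y :
  reachable e x y -> P x -> (forall u w, P u -> e u w -> P w) -> P y.
Proof.
move=> [p + ->] + Pe; elim: p x => //= z p IHp x /andP[xz zp] Px.
by apply: IHp zp _; exact: Pe xz.
Qed.

Lemma reachable_trans x y z :
  reachable e x y -> reachable e y z -> reachable e x z.
Proof.
move=> xy yz; apply: (reachable_ind (P := component e x) yz) => // u w.
exact: reachable_rcons.
Qed.

Lemma reachable_sym x y : symmetric e -> reachable e x y -> reachable e y x.
Proof.
move=> esym xy; apply: (reachable_ind (P := fun z => reachable e z x) xy).
  exact: reachable_refl.
by move=> u w ux uw; apply: reachable_cons ux; rewrite esym.
Qed.

Lemma component_eq x y :
  symmetric e -> reachable e x y -> component e y = component e x.
Proof.
move=> esym xy; apply/seteqP; split=> z; first exact: reachable_trans.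
exact/reachable_trans/reachable_sym.
Qed.

End Reachable.

Lemma delete_edgeE (V : choiceType) (e : rel V) x y u w :
  delete_edge e x y u w =
  e u w && ~~ ((u == x) && (w == y) || (u == y) && (w == x)).
Proof. by []. Qed.

Lemma delete_edgeC (V : choiceType) (e : rel V) x y :
  delete_edge e x y = delete_edge e y x.
Proof.
by apply/funext => u; apply/funext => w; rewrite !delete_edgeE orbC.
Qed.

Lemma delete_edge_sym (V : choiceType) (e : rel V) x y :
  symmetric e -> symmetric (delete_edge e x y).
Proof.
move=> esym u w; rewrite !delete_edgeE esym; congr (_ && ~~ _).
by rewrite orbC; congr (_ || _); rewrite andbC.
Qed.

(** Half-trees are the infinite sides; a side keeps track of the edge and of the
   end of that edge which define it. *)
Definition side (V : choiceType) (e : rel V) (x y : V) : set V :=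
  component (delete_edge e x y) x.

Section Sides.
Variables (V : choiceType) (e : rel V).
Hypothesis e_tree : is_tree e.

Lemma tree_sym : symmetric e. Proof. by case: e_tree. Qed.
Lemma tree_reachable x y : reachable e x y. Proof. by case: e_tree. Qed.

Lemma side_refl x y : side e x y x.
Proof. exact: reachable_refl. Qed.

(** A path joining the ends of an edge without using it would close up with it
   to a cycle. *)
Lemma side_far x y : e x y -> ~ side e x y y.
Proof.
move=> xy [p xp yp]; case: e_tree => eirr esym _ acyclic.
case: (shortenP xp) yp => q xq uq _ yq.
apply: (acyclic (x :: q)).
  case: q xq uq yq => [|a [|b q]] //=.
    by move=> _ _ yx; rewrite yx eirr in xy.
  by rewrite andbT => xa _ ya; rewrite delete_edgeE ya !eqxx andbF in xa.
rewrite /ucycle uq andbT /= rcons_path -yq esym xy andbT.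
by apply: sub_path xq => u w; rewrite delete_edgeE => /andP[].
Qed.

Lemma side_step x y u w : side e x y u -> e u w ->
  side e x y w \/ (u = x /\ w = y) \/ (u = y /\ w = x).
Proof.
move=> xu uw.
case E: ((u == x) && (w == y) || (u == y) && (w == x)).
  by case/orP: E => /andP[/eqP -> /eqP ->]; right; [left|right].
by left; apply: reachable_rcons xu _; rewrite delete_edgeE uw E.
Qed.

Lemma side_boundary x y u w : e x y -> side e x y u -> e u w ->
  ~ side e x y w -> u = x /\ w = y.
Proof.
move=> xy xu uw xw; case: (side_step xu uw) => [//|[//|[uy _]]].
by rewrite uy in xu; case: (side_far xy).
Qed.

Lemma side_cover x y z : side e x y z \/ side e y x z.
Proof.
apply: (reachable_ind (P := side e x y `|` side e y x) (tree_reachable x z))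
  => [|u w].
  by left; exact: side_refl.
case=> [xu|yu] uw.
- case: (side_step xu uw) => [|[[_ ->]|[_ ->]]]; first by left.
    by right; exact: side_refl.
  by left; exact: side_refl.
- case: (side_step yu uw) => [|[[_ ->]|[_ ->]]]; first by right.
    by left; exact: side_refl.
  by right; exact: side_refl.
Qed.

Lemma side_disjoint x y z : e x y -> side e x y z -> ~ side e y x z.
Proof.
move=> xy xz; rewrite /side delete_edgeC => yz; apply: (side_far xy).
apply: reachable_trans xz _.
by apply: reachable_sym yz; exact/delete_edge_sym/tree_sym.
Qed.

(** A side is connected, so it contains a path from [x] to [y]; and only the edge
   [c d] leads out of [side e c d]. *)
Lemma side_crossing a b c d x y : e c d ->
  side e a b x -> side e c d x -> side e a b y -> ~ side e c d y ->
  side e a b c /\ side e a b d.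
Proof.
move=> cd ax cx ay cy; apply: contrapT => abcd; apply: cy.
have xy : reachable (delete_edge e a b) x y.
  apply: reachable_trans ay; apply: reachable_sym ax.
  exact/delete_edge_sym/tree_sym.
suff [] : (side e a b `&` side e c d) y by [].
apply: (reachable_ind xy) => // u w [au cu] uw.
have aw : side e a b w by exact: reachable_rcons au uw.
split=> //; apply: contrapT => cw.
have /andP[euw _] := uw.
by have [uc wd] := side_boundary cd cu euw cw; apply: abcd; rewrite -uc -wd.
Qed.

(** By induction along a path from [x] to [y]; when the path comes back to [x],
   the neighbour [c] is chosen afresh. *)
Lemma side_towards x y : x <> y -> exists2 c, e x c & ~ side e x c y.
Proof.
move=> xy.
pose P z := z = x \/ exists2 c, e x c & side e c x z.
suff [yx|[c xc cy]] : P y.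
- by case: xy.
- by exists c => // xcy; exact: side_disjoint xc xcy cy.
apply: (reachable_ind (P := P) (tree_reachable x y)) => [|u w]; first by left.
case=> [-> xw|[c xc cu] uw]; first by right; exists w => //; exact: side_refl.
case: (side_step cu uw) => [cw|[[_ ->]|[_ ->]]]; [|by left|].
  by right; exists c.
by right; exists c => //; exact: side_refl.
Qed.

(** * Trees without leaves *)

Section Leafless.
Hypothesis leafless : forall x, exists b c, [/\ e x b, e x c & b <> c].

(** Leave [f] by an edge [f n] which does not lead to [y]: the side of [n] then
   avoids [y], hence cannot escape from the side of [x]. *)
Lemma side_avoid1 x y f : e x y -> side e x y f ->
  exists a b, [/\ e a b, side e a b `<=` side e x y & ~ side e a b f].
Proof.
move=> xy xf.
have fy : f <> y by move=> fy; rewrite fy in xf; case: (side_far xy).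
have [c fc fcy] := side_towards fy.
have cfy : side e c f y by case: (side_cover f c y).
have [n fn nc] : exists2 n, e f n & n <> c.
  case: (leafless f) => b [d [fb fd bd]]; case: (eqVneq b c) => [bc|/eqP bc].
    by exists d => // dc; apply: bd; rewrite bc dc.
  by exists b.
have nf : e n f by rewrite tree_sym.
have cf : e c f by rewrite tree_sym.
have fny : side e f n y.
  apply: contrapT => fny.
  have fnc : side e f n c.
    case: (side_step (side_refl f n) fc) => [//|[[_ cn]|[_ ->]]].
      by case: nc.
    exact: side_refl.
  have [cff _] := side_crossing fn (side_refl c f) fnc cfy fny.
  by case: (side_far cf).
have nfy : ~ side e n f y by exact: side_disjoint fny.
have xn : side e x y n.
  apply: contrapT => xn.
  have [_ ny] := side_boundary xy xf fn xn.
  by apply: nfy; rewrite -ny; exact: side_refl.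
exists n, f; split=> //; last exact: side_far.
move=> z nz; apply: contrapT => xz.
by case: (side_crossing xy (side_refl n f) xn nz xz).
Qed.

Lemma side_avoid (F : set V) x y : finite_set F -> e x y ->
  exists a b, [/\ e a b, side e a b `<=` side e x y & F `<=` ~` side e a b].
Proof.
move=> /finite_seqP[s ->] xy; elim: s => [|f s [a [b [ab abxy abs]]]].
  by exists x, y; split.
case: (pselect (side e a b f)) => abf.
  have [c [d [cd cdab cdf]]] := side_avoid1 ab abf.
  exists c, d; split=> //; first exact: subset_trans abxy.
  move=> z; rewrite /= inE => /orP[/eqP -> //|zs cdz].
  by apply: (abs z zs); exact: cdab.
by exists a, b; split=> // z; rewrite /= inE => /orP[/eqP -> //|]; exact: abs.
Qed.

(** A finite side would contain a side disjoint from it, hence empty. *)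
Lemma side_infinite x y : e x y -> infinite_set (side e x y).
Proof.
move=> xy fin; have [a [b [ab abxy abF]]] := side_avoid fin xy.
by apply: (abF a _ (side_refl a b)); exact/abxy/side_refl.
Qed.

Lemma side_half_tree x y : e x y -> half_tree e (side e x y).
Proof.
move=> xy; exists x, y; split=> //; last by exists x.
have dsym := delete_edge_sym x y tree_sym.
move=> z; case: (side_cover x y z) => [xz|].
  by rewrite (component_eq dsym xz); exact: side_infinite.
rewrite /side delete_edgeC => yz.
rewrite (component_eq dsym yz) delete_edgeC.
by apply: side_infinite; rewrite tree_sym.
Qed.

End Leafless.

(** * The vertices with two neighbours *)

Definition inner_vertices : set V :=
  [set x | exists b c, [/\ e x b, e x c & b <> c]].

(** An intermediate vertex of a path without repetitions has its predecessor and
   its successor as distinct neighbours; hence the connectedness of the subtree. *)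
Lemma inner_path x p : inner_vertices x -> path e x p -> uniq (x :: p) ->
  inner_vertices (last x p) -> {in p, forall z, inner_vertices z}.
Proof.
elim: p x => // a p IHp x Ix /= /andP[xa ap] /andP[xap uap] Il.
have Ia : inner_vertices a.
  case: p ap xap uap Il {IHp} => // b p /= /andP[ab _] xap _ _.
  exists x, b; split=> //; first by rewrite tree_sym.
  by move=> xb; rewrite !inE xb eqxx orbT in xap.
by move=> z; rewrite inE => /orP[/eqP -> //|]; exact: IHp ap uap Il z.
Qed.

Lemma subtree_inner : subtree e inner_vertices.
Proof.
case: e_tree => eirr esym econ acyclic; split.
- by move=> x; exact: eirr.
- by move=> x y; exact: esym.
- move=> [x Sx] [y Sy]; have Ix := set_mem Sx; have Iy := set_mem Sy.
  have [p0 xp0 yp0] := econ x y.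
  case: (shortenP xp0) yp0 => p xp up _ yp {p0 xp0}.
  have Ip : {in p, forall z, inner_vertices z}.
    by apply: inner_path xp up _; rewrite -?yp.
  elim: p x Sx xp yp Ip {Ix up} => [|a p IHp] x Sx /=.
    move=> _ yx _; subst y; rewrite (bool_irrelevance Sy Sx).
    exact: reachable_refl.
  move=> /andP[xa ap] yp Ip.
  have Sa : a \in inner_vertices by apply/mem_set/Ip; rewrite inE eqxx.
  apply: (reachable_cons (y := exist _ a Sa)) => //.
  by apply: IHp => // z zp; apply: Ip; rewrite inE zp orbT.
- move=> c c2 /andP[cyc uc]; apply: (acyclic (map val c)).
    by rewrite size_map.
  rewrite /ucycle map_inj_uniq ?uc ?andbT; last exact: val_inj.
  by rewrite cycle_map.
Qed.

(** If every vertex had at most one neighbour, the tree would consist of a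
   vertex and its neighbour. *)
Lemma inner_neq0 : infinite_set [set: V] -> inner_vertices !=set0.
Proof.
move=> Vinf; apply: contrapT => I0.
have one u b c : e u b -> e u c -> b = c.
  by move=> ub uc; apply: contrapT => bc; apply: I0; exists u, b, c.
have [x _] := infinite_setN0 Vinf.
have fin2 (a b : V) : ~ (forall z, z = a \/ z = b).
  move=> ab; apply: Vinf; apply: (@sub_finite_set _ _ [set` [:: a; b]]).
    by move=> z _ /=; rewrite !inE; case: (ab z) => ->; rewrite eqxx ?orbT.
  exact: finite_seq.
have [n xn] : exists n, e x n.
  apply: contrapT => xN; apply: (fin2 x x) => z; left.
  apply: (reachable_ind (P := eq^~ x) (tree_reachable x z)) => // u w -> xw.
  by case: xN; exists w.
apply: (fin2 x n) => z.
apply: (reachable_ind (P := [set x; n]) (tree_reachable x z))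
  => [|u w [->|->] uw]; first by left.
  by right; exact: one uw xn.
by left; apply: one uw _; rewrite tree_sym.
Qed.

Lemma inner_aut (g : aut e) x : inner_vertices x -> inner_vertices (g x).
Proof.
move=> [b [c [xb xc bc]]]; exists (g b), (g c).
by split; rewrite ?aut_mono // => /(bij_inj (aut_bij g)).
Qed.

Lemma inner_invariant (G : set (aut e)) : invariant_under G inner_vertices.
Proof.
move=> g _; apply/seteqP; split=> [_ [x Ix <-]|x Ix]; first exact: inner_aut.
exists (g^-1 x); first exact: inner_aut.
by rewrite -autM mulgV.
Qed.

Lemma no_leaves (G : set (aut e)) : infinite_set [set: V] ->
  (~ exists S : set V,
      [/\ subtree e S, S !=set0, S != [set: V] & invariant_under G S]) ->
  forall x, exists b c, [/\ e x b, e x c & b <> c].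
Proof.
move=> Vinf Gmin x; suff IT : inner_vertices = [set: V].
  by have : inner_vertices x by rewrite IT.
apply: contrapT => /eqP IT; apply: Gmin; exists inner_vertices; split=> //.
- exact: subtree_inner.
- exact: inner_neq0.
- exact: inner_invariant.
Qed.

End Sides.

(** * Automorphisms *)

Section Automorphisms.
Variables (V : choiceType) (e : rel V).
Hypothesis e_tree : is_tree e.
Implicit Types g h : aut e.

Lemma aut_side g x y z : side e x y z -> side e (g x) (g y) (g z).
Proof.
move=> xz; apply: (reachable_ind (P := side e (g x) (g y) \o g) xz) => /=.
  exact: side_refl.
move=> u w gu uw; apply: reachable_rcons gu _.
by rewrite delete_edgeE aut_mono !(inj_eq (bij_inj (aut_bij g))).
Qed.

(** Write [A] for [side e v p], so that [g A] is [side e (g v) (g p)]. The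
   connected set [A] does not contain [g v], through which it would have to
   leave [g A]: so [A] lies on one side of the edge joining [g v] to [g p], and
   the position of [v] tells which. *)
Lemma side_aut_disjoint g v p : e v p -> ~ side e v p (g v) ->
  ~ side e (g v) (g p) v ->
  forall z, side e v p z -> ~ side e (g v) (g p) z.
Proof.
move=> vp vgv gvv z vz gvz; apply: vgv.
have gvp : e (g v) (g p) by rewrite aut_mono.
by have [] := side_crossing e_tree gvp vz gvz (side_refl e v p) gvv.
Qed.

Lemma side_aut_sub g v p : e v p -> ~ side e v p (g v) ->
  side e (g v) (g p) v -> side e v p `<=` side e (g v) (g p).
Proof.
move=> vp vgv gvv z vz; apply: contrapT => gvz; apply: vgv.
have gvp : e (g v) (g p) by rewrite aut_mono.
by have [] := side_crossing e_tree gvp (side_refl e v p) gvv vz gvz.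
Qed.

(** The case of a [g] which pushes [A] into the larger side [g A]. *)
Section Translation.
Variables (g : aut e) (v p : V).
Hypotheses (vp : e v p) (vgv : ~ side e v p (g v)).
Hypothesis gvv : side e (g v) (g p) v.

Let A n : set V := side e ((g ^+ n) v) ((g ^+ n) p).

Lemma translate_sideV n k z : A (k + n) z -> exists2 u, A n u & z = (g ^+ k) u.
Proof.
move=> /(aut_side (g ^+ k)^-1); rewrite -!autM expgnDr !mulKg => Az.
by exists ((g ^+ k)^-1 z) => //; rewrite -autM mulgV.
Qed.

(** Together with [translate_subS]: [A n.+1] contains all neighbours of [A n],
   as [(g ^+ n) p] is the only one outside [A n]. *)
Lemma translate_far n : A n.+1 ((g ^+ n) p).
Proof.
rewrite /A expgSr !autM; apply: aut_side.
have gvp : e (g v) (g p) by rewrite aut_mono.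
apply: contrapT => gvp'.
have [vE _] := side_boundary e_tree gvp gvv vp gvp'.
by apply: vgv; rewrite -vE; exact: side_refl.
Qed.

Lemma translate_subS n : A n `<=` A n.+1.
Proof.
move=> z; rewrite -{1}[n]addn0 => /translate_sideV[u]; rewrite /A expg0 => Au ->.
by rewrite expgSr !autM; apply/aut_side/side_aut_sub.
Qed.

Lemma translate_sub n m : (n <= m)%N -> A n `<=` A m.
Proof.
move=> /subnK <-; elim: (m - n)%N => // k IHk.
exact: subset_trans IHk (@translate_subS _).
Qed.

(** Each step along a path issued from [v] costs at most one more translate. *)
Lemma translate_cover z : exists n, A n z.
Proof.
pose P z := exists n, A n z.
apply: (reachable_ind (P := P) (tree_reachable e_tree v z)).
  by exists 0%N; exact: side_refl.
move=> u w [n nu] uw; exists n.+1.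
case: (pselect (A n w)) => [|nw]; first exact: translate_subS.
have [|_ ->] := side_boundary e_tree _ nu uw nw; first by rewrite aut_mono.
exact: translate_far.
Qed.

Lemma translate_finite (F : set V) : finite_set F -> exists n, F `<=` A n.
Proof.
move=> /finite_seqP[s ->]; elim: s => [|f s [n ns]]; first by exists 0%N.
have [m mf] := translate_cover f; exists (maxn n m) => z.
rewrite /= inE => /orP[/eqP ->|zs].
  exact: translate_sub (leq_maxr _ _) _ mf.
exact: translate_sub (leq_maxl _ _) _ (ns z zs).
Qed.

End Translation.

(** The half-tree on which property H contradicts quasi-centrality of [g]. *)
Lemma half_tree_covering g (F : set V) v :
  (forall x, exists b c, [/\ e x b, e x c & b <> c]) ->
  finite_set F -> g v <> v ->
  exists H : set V, [/\ half_tree e H, F `<=` H &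
    forall z, exists n, exists2 u, H u & z = (g ^+ n) u].
Proof.
move=> leafless finF gv; have [p vp vgv] := side_towards e_tree (nesym gv).
case: (pselect (side e (g v) (g p) v)) => gvv.
  have [n Fn] := translate_finite vp vgv gvv finF.
  exists (side e ((g ^+ n) v) ((g ^+ n) p)); split=> // [|z].
    by apply: side_half_tree; rewrite // aut_mono.
  have [m mz] := translate_cover vp vgv gvv z; exists m.
  apply: translate_sideV.
  exact: translate_sub vp vgv gvv _ _ (leq_addr n m) _ mz.
have [a [b [ab abvp abF]]] := side_avoid e_tree leafless finF vp.
have ba : e b a by rewrite tree_sym.
exists (side e b a); split; first exact: side_half_tree.
  by move=> z Fz; case: (side_cover e_tree a b z) => // /(abF z Fz).
move=> z; case: (side_cover e_tree a b z) => abz; last by exists 0%N, z.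
exists 1%N, (g^-1 z); last by rewrite expg1 -autM mulgV.
case: (side_cover e_tree a b (g^-1 z)) => // /abvp /(aut_side g).
rewrite -autM mulgV => gvz.
by case: (side_aut_disjoint vp vgv gvv (abvp z abz)).
Qed.

End Automorphisms.

(** * The quasi-center *)

Lemma quasi_center_fixator (V : choiceType) (e : rel V) (G : set (aut e)) g :
  G 1 -> quasi_center G g ->
  exists2 F : set V, finite_set F &
    forall h, G h -> fixator e F h -> commute g h.
Proof.
move=> G1 [Gg /open_subspaceP[U oU UG]].
have [U1 _] : (U `&` G) 1 by rewrite UG; split=> //; split=> //; exact: commute1.
have [F finF FU] : nbhs (1 : aut e) U by exact: open_nbhs_nbhs.
exists F => // h Gh Fh.
have [] : (centralizer_in G g `&` G) h.
  by rewrite -UG; split=> //; apply: FU; exists h => //; rewrite mul1g.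
by case.
Qed.

Theorem proposition8 (V : choiceType) (e : rel V)
    (e_tree : is_tree e) (V_infinite : infinite_set [set: V])
    (G : set (aut e)) (G_group : group_closed (mem G)) (G_closed : closed G)
    (G_H : property_H G)
    (G_min : ~ exists S : set V,
      [/\ subtree e S, S !=set0, S != [set: V] & invariant_under G S]) :
  quasi_center G = [set 1].
Proof.
have leafless := no_leaves e_tree V_infinite G_min.
have G1 : G 1 by case: G_group => /set_mem.
apply/seteqP; split=> [g gQ|_ ->]; last first.
  split=> //; apply/open_subspaceP; exists setT; first exact: openT.
  apply/seteqP; split=> h [_ Gh]; split=> //; split=> //.
  exact/commute_sym/commute1.
have [F finF FC] := quasi_center_fixator G1 gQ.
(* If [g] moves [v], some [h != 1] fixes all translates of a half-tree [H], and
   these translates cover the tree. *)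
apply: autP => v; apply: contrapT => gv.
have [H [htH FH Hcover]] := half_tree_covering e_tree leafless finF gv.
have [h [Gh hH] /eqP h1] := G_H H htH.
have gh : commute g h by apply: FC => // x /FH; exact: hH.
apply: h1; apply: autP => z; have [n [u Hu ->]] := Hcover z.
have /= hg := commuteX n (commute_sym gh).
by rewrite -autM hg autM hH.
Qed.
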